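(* Let $q\in\{5,6\}$. The second length of the length spectrum of the triangle group $\Gamma(3,3,q)$ (that is, its second smallest distinct value) is equal to $$2\,\mathrm{arccosh}\Big(2\cos^2\tfrac{\pi}{q}+\cos\tfrac{\pi}{q}-\tfrac12\Big),$$ and this length has multiplicity at least $2$.
   Context: Let $\mathbf H$ be the hyperbolic plane with its distance $d$. Let $T$ be a hyperbolic triangle with angles $\pi/3,\pi/3,\pi/q$; the triangle group $\Gamma(3,3,q)$ is the group of orientation-preserving elements of the group generated by the reflections in the sides of $T$. For a hyperbolic element $\gamma$ its length is $l(\gamma)=\inf\{d(x,\gamma x): x\in\mathbf H\}$. The length spectrum is the family of the numbers $l(\gamma)$ as $\gamma$ runs over the $\Gamma(3,3,q)$-conjugacy classes of hyperbolic elements of $\Gamma(3,3,q)$, and the multiplicity of a length is the number of such conjugacy classes having that length. *)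

(* Defs.v *)
From HB Require Import structures.
From mathcomp Require Import all_boot all_order all_algebra.
From mathcomp Require Import all_classical all_reals all_analysis.
From mathcomp Require Import complex.

Set Implicit Arguments.
Unset Strict Implicit.
Unset Printing Implicit Defensive.

Import Order.TTheory GRing.Theory Num.Theory.
Local Open Scope classical_set_scope.
Local Open Scope ring_scope.
Local Open Scope complex_scope.
Local Notation normc := ComplexField.Normc.normc.

(* The hyperbolic plane is the upper half-plane with metric |dz| / Im z.
   Isometries are represented as maps hplane R -> hplane R. *)
Record hplane (R : realType) := HPlane {
  hval :> R[i];
  hval_gt0 : 0 < complex.Im hval }.

HB.instance Definition _ (R : realType) := [isSub for @hval R].
HB.instance Definition _ (R : realType) := [Choice of hplane R by <:].

Section Plane.
Variable R : realType.
Implicit Types (P Q S z w : hplane R) (c : R) (f g k : hplane R -> hplane R).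

Definition arcosh (x : R) : R := ln (x + Num.sqrt (x ^+ 2 - 1)).

Definition hdist z w : R :=
  arcosh (1 + normc (hval z - hval w) ^+ 2
              / (2 * complex.Im z * complex.Im w)).

(* The geodesic through P != Q is the vertical half-line Re z = Re P when
   Re P = Re Q, and otherwise the half-circle through P with the following
   centre on the real axis, the real point equidistant from P and Q for the
   Euclidean distance. *)
Definition centre P Q : R :=
  (normc Q ^+ 2 - normc P ^+ 2)
    / (2 * (complex.Re Q - complex.Re P)).

Lemma mirror_gt0 c z :
  0 < complex.Im ((2 * c - complex.Re z) +i* complex.Im z).
Proof. exact: hval_gt0. Qed.

Definition mirror c z : hplane R := HPlane (mirror_gt0 c z).

Lemma inversion_gt0 c P z :
  0 < complex.Im (c%:C + (normc (hval P - c%:C) ^+ 2)%:C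
                           / ((hval z)^* - c%:C)).
Proof.
case: P z => [[a b] /= b0] [[x y] /= y0].
rewrite oppr0 !addr0 !add0r !mul0r addr0 sqrrN mulNr opprK sqr_sqrtr; last first.
  by rewrite addr_ge0 ?sqr_ge0.
rewrite mulr_gt0 ?divr_gt0 //.
  by rewrite ltr_wpDl ?sqr_ge0 // exprn_gt0.
by rewrite ltr_wpDl ?sqr_ge0 // exprn_gt0.
Qed.

(* Inversion in the Euclidean circle with centre c passing through P. *)
Definition inversion c P z : hplane R := HPlane (inversion_gt0 c P z).

(* Hyperbolic reflection in the geodesic through P and Q. *)
Definition reflection P Q : hplane R -> hplane R :=
  if complex.Re P == complex.Re Q then mirror (complex.Re P)
  else inversion (centre P Q) P.

(* A vector tangent at P to the geodesic segment from P to Q and pointing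
   towards Q: when the geodesic is a half-circle it is orthogonal to the
   Euclidean radius, and its horizontal component has the sign of
   Re Q - Re P. *)
Definition direction P Q : R[i] :=
  if complex.Re P == complex.Re Q then 0 +i* (complex.Im Q - complex.Im P)
  else (complex.Re Q - complex.Re P)%:C
       * (complex.Im P +i* (centre P Q - complex.Re P)).

(* The hyperbolic metric is conformal to the Euclidean one, so the angle at P
   between the segments PQ and PS is the Euclidean angle of their tangents. *)
Definition angle P Q S : R :=
  let u := direction P Q in
  let v := direction P S in
  acos ((complex.Re u * complex.Re v + complex.Im u * complex.Im v)
        / (normc u * normc v)).

(* Distinct collinear points have angles in {0, pi}, so for angles strictly
   between 0 and pi the triangle is automatically nondegenerate. *)
Definition triangle_with_angles (A B C : hplane R) (alpha beta gamma : R) :=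
  [/\ A <> B, B <> C & C <> A] /\
  [/\ angle A B C = alpha, angle B C A = beta & angle C A B = gamma].

Inductive generated (X : set (hplane R -> hplane R)) :
    (hplane R -> hplane R) -> Prop :=
| generated_in f of X f : generated X f
| generated_id : generated X id
| generated_comp f g of generated X f & generated X g : generated X (f \o g)
| generated_inv f g of generated X f & cancel f g & cancel g f :
    generated X g.

Definition side_reflections (A B C : hplane R) : set (hplane R -> hplane R) :=
  [set reflection A B; reflection B C; reflection C A].

(* f is the homography z |-> (a z + b) / (c z + d) of M = (a b; c d). *)
Definition homography (M : 'M[R]_2) f : Prop :=
  forall z, hval (f z) = ((M 0 0)%:C * hval z + (M 0 1)%:C)
                         / ((M 1 0)%:C * hval z + (M 1 1)%:C).

(* The orientation-preserving isometries are the elements of PSL_2(R). *)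
Definition orientation_preserving f : Prop :=
  exists2 M : 'M[R]_2, \det M = 1 & homography M f.

Definition hyperbolic f : Prop :=
  exists M : 'M[R]_2, [/\ \det M = 1, homography M f & 2 < `|\tr M|].

Definition triangle_group (A B C : hplane R) : set (hplane R -> hplane R) :=
  [set f | generated (side_reflections A B C) f /\ orientation_preserving f].

Definition len f : R := inf (range (fun x => hdist x (f x))).

Implicit Type G : set (hplane R -> hplane R).

(* For a group G of bijections, g \o k = k \o f says g = k f k^-1. *)
Definition conj_class G f : set (hplane R -> hplane R) :=
  [set g : hplane R -> hplane R | exists2 k, G k & g \o k = k \o f].

Definition length_spectrum G : set R :=
  [set len f | f in [set f | G f /\ hyperbolic f]].

Definition classes_of_length G (l : R) : set (set (hplane R -> hplane R)) :=
  [set conj_class G f | f in [set f | [/\ G f, hyperbolic f & len f = l]]].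

Definition least (E : set R) (m : R) : Prop := E m /\ lbound E m.

Definition second_least (E : set R) (m : R) : Prop :=
  exists2 m1, least E m1 & least (E `\ m1) m.

End Plane.

(* Main.v *)
Require Import Defs.
From mathcomp Require Import all_boot all_order all_algebra.
From mathcomp Require Import all_classical all_reals all_analysis.
From mathcomp Require Import complex ring lra zify.

(** Write lam for 2 cos(pi/q).  The reflections in the sides AB, BC, CA are
    z |-> R_i(conj z) for real matrices R1, R2, R3 of trace 0 and determinant
    -1.  Their products have the traces -1, -1, -lam, minus twice the cosines
    of the angles ([refl_mxC], [cos_angle]), so each element of the triangle
    group is the homography of an x = a + b R1R2 + c R1R3 + d R2R3, with
    a, b, c, d in Z[lam] and norm [qnorm] equal to 1 ([triangle_lattice]).
    The length of a hyperbolic element is 2 arcosh(t/2), where t > 2 is the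
    absolute value of its trace ([len_homography]), so the first assertion
    concerns the traces t.

    Such a trace lies in Z[lam].  The number lam has one other conjugate,
    1 - lam for q = 5 and -lam for q = 6, and it lies in the interval [-2, 1],
    where the norm form is positive semidefinite: 4 norm - trace^2 is a sum of
    nonnegative terms ([qtrace_bound]).  Hence the conjugate of t is at most 2
    in absolute value.  Together with the bound t < tau on t itself, where
    tau = lam^2 + lam - 1, this leaves finitely many elements of Z[lam], and
    the only one with t > 2 is t = lam + 1 ([trace_gap5], [trace_gap6]).  The
    products R1R2 R1R3 and [second_elt] have the traces lam + 1 and -tau, which
    gives the two smallest lengths.

    For the multiplicity, let S be [second_elt]; its inverse has the same
    length.  An element K of determinant 1 that conjugates S to its inverse,
    up to sign, satisfies tr K = tr(SK) = 0 ([inverting_traceless]).  There is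
    a prime of Z[lam], over 5 for q = 5 and over 2 for q = 6, modulo which
    lam^2 + lam - 2 vanishes; it contains tr[R1R2, R1R3] - 2, so modulo it
    the order spanned by 1, R1R2, R1R3, R2R3 has a commutative quotient, in
    which S becomes, up to sign, a primitive cube root of unity.  There the
    two equations force the norm of K to vanish, which contradicts norm 1
    ([no_inverting_element5], [no_inverting_element6]). *)

Set Implicit Arguments.
Unset Strict Implicit.
Unset Printing Implicit Defensive.

Import Order.TTheory GRing.Theory Num.Theory.
Local Open Scope classical_set_scope.
Local Open Scope card_scope.
Local Open Scope ring_scope.

(** * Two by two matrices *)

Section TwoByTwo.
Variable K : comNzRingType.
Implicit Types M N : 'M[K]_2.

Lemma mul_mx22 M N i j : (M * N) i j = M i 0 * N 0 j + M i 1 * N 1 j.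
Proof.
rewrite -mulmxE mxE big_ord_recl big_ord1.
by have -> : lift ord0 ord0 = 1 :> 'I_2 by apply: val_inj.
Qed.

Lemma add_mxE M N i j : (M + N) i j = M i j + N i j.
Proof. by rewrite mxE. Qed.

Lemma opp_mxE M i j : (- M) i j = - M i j.
Proof. by rewrite mxE. Qed.

Lemma scale_mxE a M i j : (a *: M) i j = a * M i j.
Proof. by rewrite mxE. Qed.

Lemma scalar_mxE a i j : (a%:M : 'M[K]_2) i j = a * (i == j)%:R.
Proof. by rewrite mxE mulr_natr. Qed.

Lemma one_mxE i j : (1 : 'M[K]_2) i j = (i == j)%:R.
Proof. by rewrite mxE. Qed.

Definition mx22E := (mul_mx22, add_mxE, opp_mxE, scale_mxE, scalar_mxE, one_mxE).

Lemma eq_mx22 M N : M 0 0 = N 0 0 -> M 0 1 = N 0 1 ->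
  M 1 0 = N 1 0 -> M 1 1 = N 1 1 -> M = N.
Proof.
move=> h00 h01 h10 h11; apply/matrixP=> i j.
have E (k : 'I_2) : k = 0 \/ k = 1.
  by case: k => [[|[|//]] ?]; [left|right]; apply: val_inj.
by case: (E i) => ->; case: (E j) => ->.
Qed.

Lemma mxtr22 M : \tr M = M 0 0 + M 1 1.
Proof.
rewrite /mxtrace big_ord_recl big_ord1.
by have -> : lift ord0 ord0 = 1 :> 'I_2 by apply: val_inj.
Qed.

Lemma mul_scalar_mx22 a M : a%:M * M = a *: M.
Proof. exact: mul_scalar_mx. Qed.

Lemma mul_mx22_scalar a M : M * a%:M = a *: M.
Proof. exact: mul_mx_scalar. Qed.

Lemma det_mx22 M : \det M = M 0 0 * M 1 1 - M 0 1 * M 1 0.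
Proof.
rewrite (expand_det_row _ 0) big_ord_recl big_ord1 /cofactor !det_mx11 !mxE.
have -> : lift ord0 ord0 = 1 :> 'I_2 by apply: val_inj.
have -> : lift 1 ord0 = 0 :> 'I_2 by apply: val_inj.
by rewrite /= expr0 expr1 mul1r mulN1r mulrN.
Qed.

Definition mat2 (a b c d : K) : 'M[K]_2 :=
  \matrix_(i, j) if i == 0 then if j == 0 then a else b
                 else if j == 0 then c else d.

Lemma mat2E a b c d :
  ((mat2 a b c d 0 0 = a) * (mat2 a b c d 0 1 = b)) *
  ((mat2 a b c d 1 0 = c) * (mat2 a b c d 1 1 = d)).
Proof. by rewrite !mxE. Qed.

(** Polarization of M^2 = -(det M): the anticommutator of two traceless
    matrices is the scalar tr(MN). *)
Lemma traceless_mul M N : \tr M = 0 -> \tr N = 0 ->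
  N * M = (\tr (M * N))%:M - M * N.
Proof.
rewrite !mxtr22 => /eqP; rewrite addr_eq0 => /eqP hM /eqP.
rewrite addr_eq0 => /eqP hN.
by apply: eq_mx22; rewrite !mx22E hM hN /=; ring.
Qed.

Lemma traceless_sq M : \tr M = 0 -> \det M = -1 -> M * M = 1.
Proof.
rewrite mxtr22 det_mx22 => /eqP; rewrite addr_eq0 => /eqP h00; rewrite h00 => hd.
have h1 : M 1 1 * M 1 1 + M 0 1 * M 1 0 = 1 by rewrite -[RHS]opprK -hd; ring.
apply: eq_mx22; rewrite !mx22E ?h00 /= ?mulr0 ?mulr1 -?[RHS]h1; ring.
Qed.

End TwoByTwo.

(** * The quaternion order of the triangle group *)

Section QuaternionOrder.

(** Norm and trace forms, in the basis 1, R1R2, R1R3, R2R3, of the quaternion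
    algebra generated by products of two reflections whose traces are
    -1, -1, -l. *)
Definition qnorm (K : comNzRingType) (l a b c d : K) : K :=
  a ^+ 2 + b ^+ 2 + c ^+ 2 + d ^+ 2 - a * b - a * c - l * a * d
  - l * b * c + (l + 1) * b * d - c * d.

Definition qtrace (K : comNzRingType) (l a b c d : K) : K :=
  2 * a - b - c - l * d.

(** For l in [-2, 1] the norm form is positive semidefinite, and
    4 qnorm - qtrace^2 is a combination of squares with the nonnegative
    coefficients 1 - l and 2 + l. *)
Lemma qtrace_bound (K : realDomainType) (l a b c d : K) :
  -2 <= l <= 1 -> qnorm l a b c d = 1 -> qtrace l a b c d ^+ 2 <= 4.
Proof.
move=> /andP[l2 l1] h; rewrite -subr_ge0.
have -> : 4 - qtrace l a b c d ^+ 2 =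
    4 * (1 - qnorm l a b c d) + ((1 - l) * (b + c) ^+ 2 +
    (2 + l) * ((b - c + d) ^+ 2 + (1 - l) * d ^+ 2)).
  by rewrite /qnorm /qtrace; ring.
rewrite h subrr mulr0 add0r.
have h1 : 0 <= 1 - l by lra.
have h2 : 0 <= 2 + l by lra.
apply: addr_ge0; first by rewrite mulr_ge0 // sqr_ge0.
by rewrite mulr_ge0 // addr_ge0 ?sqr_ge0 // mulr_ge0 // sqr_ge0.
Qed.

Variables (K : idomainType) (l : K) (R1 R2 R3 : 'M[K]_2).
Hypotheses (sq1 : R1 * R1 = 1) (sq2 : R2 * R2 = 1) (sq3 : R3 * R3 = 1).
Hypotheses (tr1 : \tr R1 = 0) (tr2 : \tr R2 = 0) (tr3 : \tr R3 = 0).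
Hypotheses (tr12 : \tr (R1 * R2) = -1) (tr13 : \tr (R1 * R3) = -1).
Hypothesis (tr23 : \tr (R2 * R3) = - l).

Let r21 : R2 * R1 = - 1 - R1 * R2.
Proof. by rewrite (traceless_mul tr1 tr2) tr12 raddfN. Qed.

Let r31 : R3 * R1 = - 1 - R1 * R3.
Proof. by rewrite (traceless_mul tr1 tr3) tr13 raddfN. Qed.

Let r32 : R3 * R2 = (- l)%:M - R2 * R3.
Proof. by rewrite (traceless_mul tr2 tr3) tr23. Qed.

Let i := R1 * R2.
Let j := R1 * R3.
Let m := R2 * R3.

Definition qelt (a b c d : K) : 'M[K]_2 :=
  a%:M + b *: (R1 * R2) + c *: (R1 * R3) + d *: (R2 * R3).

Lemma mul_ii : i * i = - 1 - i.
Proof.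
by rewrite /i -mulrA [R2 * _]mulrA r21 mulrBl mulrBr -mulrA sq2 mulr1 sq1
  mulN1r mulrN addrC.
Qed.

Lemma mul_ij : i * j = - j - m.
Proof.
by rewrite /i /j /m -mulrA [R2 * _]mulrA r21 mulrBl mulrBr -!mulrA mulN1r mulrN
  [R1 * (R1 * _)]mulrA sq1 mul1r.
Qed.

Lemma mul_im : i * m = j.
Proof. by rewrite /i /j /m -mulrA [R2 * (R2 * _)]mulrA sq2 mul1r. Qed.

Lemma mul_ji : j * i = l%:M - i + m.
Proof.
rewrite /i /j /m -mulrA [R3 * _]mulrA r31 mulrBl mulrBr -!mulrA mulN1r mulrN.
rewrite [R1 * (R1 * _)]mulrA sq1 mul1r r32 opprB raddfN /= opprK.
by rewrite [R2 * R3 + _]addrC addrA [- _ + _]addrC.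
Qed.

Lemma mul_jj : j * j = - 1 - j.
Proof.
by rewrite /j -mulrA [R3 * _]mulrA r31 mulrBl mulrBr -mulrA sq3 mulr1 sq1
  mulN1r mulrN addrC.
Qed.

Lemma mul_jm : j * m = - l *: j - i.
Proof.
rewrite /i /j /m -mulrA [R3 * _]mulrA r32 mulrBl mulrBr -!mulrA sq3 mulr1.
by rewrite mul_scalar_mx22 scalerAr.
Qed.


(** The four lemmas below show that the span of 1, R1R2, R1R3, R2R3 is stable
    under left multiplication by products of two reflections. *)
Lemma mul_qelt12 a b c d :
  R1 * R2 * qelt a b c d = qelt (- b) (a - b) (d - c) (- c).
Proof.
rewrite /qelt !mulrDr -!scalerAr mul_mx22_scalar mul_ii mul_ij mul_im /i /j /m.
apply/matrixP=> p r; rewrite !(add_mxE, opp_mxE, scale_mxE, scalar_mxE, one_mxE); ring.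
Qed.

Lemma mul_qelt13 a b c d :
  R1 * R3 * qelt a b c d = qelt (l * b - c) (- b - d) (a - c - l * d) b.
Proof.
rewrite /qelt !mulrDr -!scalerAr mul_mx22_scalar mul_ji mul_jj mul_jm /i /j /m.
apply/matrixP=> p r; rewrite !(add_mxE, opp_mxE, scale_mxE, scalar_mxE, one_mxE); ring.
Qed.

Lemma mul_qelt21 a b c d :
  R2 * R1 * qelt a b c d = qelt (b - a) (- a) (- d) (c - d).
Proof.
rewrite r21 mulrBl mulN1r mul_qelt12 /qelt.
apply/matrixP=> p r; rewrite !(add_mxE, opp_mxE, scale_mxE, scalar_mxE, one_mxE); ring.
Qed.

Lemma mul_qelt31 a b c d :
  R3 * R1 * qelt a b c d = qelt (c - a - l * b) d (l * d - a) (- b - d).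
Proof.
rewrite r31 mulrBl mulN1r mul_qelt13 /qelt.
apply/matrixP=> p r; rewrite !(add_mxE, opp_mxE, scale_mxE, scalar_mxE, one_mxE); ring.
Qed.


Lemma trace_qelt a b c d : \tr (qelt a b c d) = qtrace l a b c d.
Proof.
by rewrite /qelt !raddfD /= !mxtraceZ mxtrace_scalar tr12 tr13 tr23 /qtrace; ring.
Qed.

(** Its trace turns out to be the smallest one above 2 in the group. *)
Definition first_elt := R1 * R2 * (R1 * R3).

Lemma trace_first_elt : \tr first_elt = l + 1.
Proof. by rewrite /first_elt mul_ij raddfB raddfN /= tr13 tr23; ring. Qed.

(** This is u v u v^-1 for the matrices u = R1R3 and v = R2R1 of rotations of
    order 3 about two vertices of the triangle. *)
Definition second_elt := R1 * R3 * (R2 * R1) * (R1 * R3) * (R1 * R2).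

(** The linear form x |-> tr(S x) in coordinates, S being [second_elt]. *)
Definition qtrace2 (K : comNzRingType) (l a b c d : K) : K :=
  (1 - l ^+ 2) * qtrace l a b c d + (l ^+ 2 - l - 1) * a - b + (l + 1) * c
  + (l - 1 - l ^+ 3) * d.

Lemma trace_second_qelt a b c d :
  \tr (second_elt * qelt a b c d) = qtrace2 l a b c d.
Proof.
rewrite /second_elt -3!mulrA !(mul_qelt12, mul_qelt13, mul_qelt21, mul_qelt31).
by rewrite trace_qelt /qtrace2 /qtrace; ring.
Qed.

Lemma trace_second_elt : \tr second_elt = 1 - l - l ^+ 2.
Proof.
have <- : second_elt * qelt 1 0 0 0 = second_elt.
  by rewrite /qelt !scale0r !addr0 mulr1.
by rewrite trace_second_qelt /qtrace2 /qtrace; ring.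
Qed.

(** The coordinate changes of [mul_qelt12] to [mul_qelt31] are isometries of
    the norm form over every commutative ring, in particular over the
    polynomials in lam. *)
Lemma qnorm12 (A : comNzRingType) (x a b c d : A) :
  qnorm x (- b) (a - b) (d - c) (- c) = qnorm x a b c d.
Proof. by rewrite /qnorm; ring. Qed.

Lemma qnorm13 (A : comNzRingType) (x a b c d : A) :
  qnorm x (x * b - c) (- b - d) (a - c - x * d) b = qnorm x a b c d.
Proof. by rewrite /qnorm; ring. Qed.

Lemma qnorm21 (A : comNzRingType) (x a b c d : A) :
  qnorm x (b - a) (- a) (- d) (c - d) = qnorm x a b c d.
Proof. by rewrite /qnorm; ring. Qed.

Lemma qnorm31 (A : comNzRingType) (x a b c d : A) :
  qnorm x (c - a - x * b) d (x * d - a) (- b - d) = qnorm x a b c d.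
Proof. by rewrite /qnorm; ring. Qed.

End QuaternionOrder.

(** * Traces in Z[lam] and their conjugates *)

Section Evaluation.
Variable K : comNzRingType.

(** Elements of Z[lam] are represented by integer polynomials, so that one
    polynomial has a value at lam, at its conjugate, and modulo a prime. *)
Definition ev (l : K) (p : {poly int}) : K := (map_poly intr p).[l].

Lemma evD l p r : ev l (p + r) = ev l p + ev l r.
Proof. by rewrite /ev rmorphD hornerD. Qed.

Lemma evN l p : ev l (- p) = - ev l p.
Proof. by rewrite /ev rmorphN hornerN. Qed.

Lemma evM l p r : ev l (p * r) = ev l p * ev l r.
Proof. by rewrite /ev rmorphM hornerM. Qed.

Lemma evX l : ev l 'X = l.
Proof. by rewrite /ev map_polyX hornerX. Qed.

Lemma evC l (m : int) : ev l m%:P = m%:~R.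
Proof. by rewrite /ev map_polyC hornerC. Qed.

Lemma ev1 l : ev l 1 = 1.
Proof. by rewrite (evC l 1). Qed.

Lemma evXn l p n : ev l (p ^+ n) = ev l p ^+ n.
Proof. by rewrite /ev rmorphXn horner_exp. Qed.

Definition evE := (evD, evN, evM, evX, ev1, evXn).

Lemma ev_qnorm l (a b c d : {poly int}) :
  ev l (qnorm 'X a b c d) = qnorm l (ev l a) (ev l b) (ev l c) (ev l d).
Proof. by rewrite /qnorm !evE. Qed.

Lemma ev_qtrace l (a b c d : {poly int}) :
  ev l (qtrace 'X a b c d) = qtrace l (ev l a) (ev l b) (ev l c) (ev l d).
Proof. by rewrite /qtrace mulr_natl mulr2n !evE; ring. Qed.

Lemma ev_qtrace2 l (a b c d : {poly int}) :
  ev l (qtrace2 'X a b c d) = qtrace2 l (ev l a) (ev l b) (ev l c) (ev l d).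
Proof. by rewrite /qtrace2 !(evE, ev_qtrace). Qed.

End Evaluation.

Lemma poly_mod_quadratic (s p : int) (P : {poly int}) :
  exists m n D, P = m%:P + n%:P * 'X + D * ('X^2 - s%:P * 'X - p%:P).
Proof.
elim/poly_ind: P => [|P c [m [n [D ->]]]].
  by exists 0, 0, 0; rewrite !mul0r !addr0.
exists (c + n * p), (m + n * s), (D * 'X + n%:P).
by rewrite !rmorphD !rmorphM /=; ring.
Qed.

Section TraceGap.
Variable R : realFieldType.
Implicit Types (lam : R) (P : {poly int}).

(** Write the trace as m + n lam.  Its difference n (2 lam - 1) from the
    conjugate lies in (0, 2 lam + 2), so that n is 1 or 2; then n = 2 leaves
    no integer m, and n = 1 leaves only m = 1. *)
Lemma trace_gap5 lam P : 0 < lam -> lam ^+ 2 = lam + 1 ->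
  ev (1 - lam) P ^+ 2 <= 4 -> 2 < ev lam P -> ev lam P < lam ^+ 2 + lam - 1 ->
  ev lam P = lam + 1.
Proof.
move=> l0 l2; have [m [n [D ->]]] := poly_mod_quadratic 1 1 P.
rewrite !evE !evC ?mulr1z.
have -> : lam ^+ 2 - 1 * lam - 1 = 0 by rewrite l2; ring.
have -> : (1 - lam) ^+ 2 - 1 * (1 - lam) - 1 = 0.
  by rewrite -[0](subrr (lam ^+ 2)) {2}l2; ring.
rewrite !mulr0 !addr0 l2 => tb t2 tl.
have l125 : 5 / 4 < lam by nra.
have lt2 : lam < 2 by nra.
have [b1 b2] : -2 <= m%:~R + n%:~R * (1 - lam) /\ m%:~R + n%:~R * (1 - lam) <= 2.
  by split; nra.
have n0 : 0 < n.
  rewrite -(ltr_int R); rewrite -(pmulr_lgt0 (x := 2 * lam - 1)); lra.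
have n3 : n < 3.
  rewrite -(ltr_int R) ltNge; apply/negP => h.
  have := ler_wpM2r (_ : 0 <= 2 * lam - 1) h; lra.
have [n1|n2] : n = 1 \/ n = 2 by lia.
- rewrite n1 in t2 tl *.
  have m0 : 0 < m by rewrite -(ltr_int R); lra.
  have m2 : m < 2 by rewrite -(ltr_int R); lra.
  have -> : m = 1 by lia.
  by rewrite !mulr1z; ring.
- rewrite n2 in t2 tl b1.
  have m0 : m < 0 by rewrite -(ltr_int R); lra.
  have m1 : -1 < m by rewrite -(ltr_int R); lra.
  lia.
Qed.

(** Here the difference from the conjugate is 2 n lam and lies in
    (0, lam + 4), so that n = 1, and then m = 1. *)
Lemma trace_gap6 lam P : 0 < lam -> lam ^+ 2 = 3 ->
  ev (- lam) P ^+ 2 <= 4 -> 2 < ev lam P -> ev lam P < lam ^+ 2 + lam - 1 ->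
  ev lam P = lam + 1.
Proof.
move=> l0 l2; have [m [n [D ->]]] := poly_mod_quadratic 0 3 P.
rewrite !evE !evC ?mulr0z.
have -> : lam ^+ 2 - 0 * lam - 3%:~R = 0 by rewrite l2; ring.
have -> : (- lam) ^+ 2 - 0 * (- lam) - 3%:~R = 0 by rewrite sqrrN l2; ring.
rewrite !mulr0 !addr0 l2 => tb t2 tl.
have l15 : 3 / 2 < lam by nra.
have lt2 : lam < 2 by nra.
have [b1 b2] : -2 <= m%:~R + n%:~R * (- lam) /\ m%:~R + n%:~R * (- lam) <= 2.
  by split; nra.
have n0 : 0 < n.
  rewrite -(ltr_int R); rewrite -(pmulr_lgt0 (x := 2 * lam)); lra.
have n2 : n < 2.
  rewrite -(ltr_int R) ltNge; apply/negP => h.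
  have := ler_wpM2r (_ : 0 <= 2 * lam) h; lra.
have n1 : n = 1 by lia.
rewrite n1 in t2 tl *.
have m0 : 0 < m by rewrite -(ltr_int R); lra.
have m2 : m < 2 by rewrite -(ltr_int R); lra.
have -> : m = 1 by lia.
by rewrite !mulr1z; ring.
Qed.

End TraceGap.

(** * Reduction modulo a prime *)

Section Reduction.
Variable R : realFieldType.
Implicit Types (lam : R) (P : {poly int}).

(** Substituting -2 for lam is a reduction Z[lam] -> Z/5, as
    lam^2 - lam - 1 becomes 5.  If m + n lam vanishes, so does its norm
    m^2 + m n - n^2, which is (m - 2n)^2 modulo 5. *)
Lemma ev_eq0_mod5 lam P : lam ^+ 2 = lam + 1 -> ev lam P = 0 ->
  exists e : int, ev (-2) P = 5 * e.
Proof.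
move=> l2; have [m [n [D ->]]] := poly_mod_quadratic 1 1 P.
rewrite !evE !evC ?mulr1z.
have -> : lam ^+ 2 - 1 * lam - 1 = 0 by rewrite l2; ring.
rewrite mulr0 addr0 => mn0.
have norm0 : m ^+ 2 + m * n - n ^+ 2 = 0.
  apply/eqP; rewrite -(intr_eq0 R); apply/eqP.
  rewrite rmorphB rmorphD !rmorphM /= -(mul0r (m%:~R + n%:~R * (1 - lam))) -mn0.
  have -> : (m%:~R + n%:~R * lam) * (m%:~R + n%:~R * (1 - lam)) =
    m%:~R ^+ 2 + m%:~R * n%:~R + n%:~R ^+ 2 * (lam - lam ^+ 2) :> R by ring.
  by rewrite l2; ring.
have [e he] : exists e, m - 2 * n = 5 * e.
  have : (5 %| (m - 2 * n) ^+ 2)%Z.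
    apply/dvdzP; exists (n ^+ 2 - m * n).
    rewrite -[RHS]add0r -norm0; ring.
  rewrite (_ : (5 %| _ ^+ 2)%Z = (5 %| m - 2 * n)%Z).
    by move/dvdzP => [e ->]; exists e; rewrite mulrC.
  by rewrite !dvdzE abszX Euclid_dvdX // andbT.
exists (e + ev (-2) D).
rewrite [RHS]mulrDr -he !intz; ring.
Qed.

(** Substituting 1 for lam is the reduction Z[sqrt 3] -> Z/2, and the norm
    m^2 - 3n^2 is (m + n)^2 modulo 2. *)
Lemma ev_eq0_mod2 lam P : lam ^+ 2 = 3 -> ev lam P = 0 ->
  exists e : int, ev 1 P = 2 * e.
Proof.
move=> l2; have [m [n [D ->]]] := poly_mod_quadratic 0 3 P.
rewrite !evE !evC ?mulr0z.
have -> : lam ^+ 2 - 0 * lam - 3%:~R = 0 by rewrite l2; ring.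
rewrite mulr0 addr0 => mn0.
have norm0 : m ^+ 2 - 3 * n ^+ 2 = 0.
  apply/eqP; rewrite -(intr_eq0 R); apply/eqP.
  rewrite rmorphB !rmorphM /= -(mul0r (m%:~R - n%:~R * lam)) -mn0.
  have -> : (m%:~R + n%:~R * lam) * (m%:~R - n%:~R * lam) =
    m%:~R ^+ 2 - n%:~R ^+ 2 * lam ^+ 2 :> R by ring.
  by rewrite l2; ring.
have [e he] : exists e, m + n = 2 * e.
  have : (2 %| (m + n) ^+ 2)%Z.
    apply/dvdzP; exists (2 * n ^+ 2 + m * n).
    rewrite -[LHS]subr0 -norm0; ring.
  rewrite (_ : (2 %| _ ^+ 2)%Z = (2 %| m + n)%Z).
    by move/dvdzP => [e ->]; exists e; rewrite mulrC.
  by rewrite !dvdzE abszX Euclid_dvdX // andbT.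
exists (e - ev 1 D).
rewrite [RHS]mulrBr -he !intz; ring.
Qed.

(** At lam = -2 the two linear equations give b + c = a + d = 0 modulo 5,
    while the norm form becomes (a + d)^2 - (a + d)(b + c) + (b + c)^2. *)
Lemma no_inverting_element5 lam (a b c d : {poly int}) : lam ^+ 2 = lam + 1 ->
  qnorm 'X a b c d = 1 -> ev lam (qtrace 'X a b c d) = 0 ->
  ev lam (qtrace2 'X a b c d) = 0 -> False.
Proof.
move=> l2 /(congr1 (ev (-2 : int))) + /(ev_eq0_mod5 l2)[e] + /(ev_eq0_mod5 l2)[f].
rewrite ev1 ev_qnorm ev_qtrace ev_qtrace2.
move: (ev _ a) (ev _ b) (ev _ c) (ev _ d) => {}a {}b {}c {}d.
rewrite /qtrace2 => N1 T0; rewrite T0 => B0.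
have hbc : b + c = 5 * (a + d - 3 * e - f).
  by rewrite -[LHS]addr0 -(subrr (5 * f)) -{1}B0; ring.
have had : 2 * (a + d) = 5 * e + (b + c) by rewrite -T0 /qtrace; ring.
have [v hv] : exists v, b = 5 * v - c by exists (a + d - 3 * e - f); lia.
have [u hu] : exists u, d = 5 * u - a by exists (a + d - 2 * e - 2 * v); lia.
have : 5 * (5 * (u ^+ 2 - u * v + v ^+ 2)) = 1 :> int.
  by rewrite -[RHS]N1 hv hu /qnorm; ring.
lia.
Qed.

(** At lam = 1 the two linear equations give a = c = b + d modulo 2, and then
    the norm form is even. *)
Lemma no_inverting_element6 lam (a b c d : {poly int}) : lam ^+ 2 = 3 ->
  qnorm 'X a b c d = 1 -> ev lam (qtrace 'X a b c d) = 0 ->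
  ev lam (qtrace2 'X a b c d) = 0 -> False.
Proof.
move=> l2 /(congr1 (ev (1 : int))) + /(ev_eq0_mod2 l2)[e] + /(ev_eq0_mod2 l2)[f].
rewrite ev1 ev_qnorm ev_qtrace ev_qtrace2.
move: (ev _ a) (ev _ b) (ev _ c) (ev _ d) => {}a {}b {}c {}d.
rewrite /qtrace2 /qtrace => N1 T0 B0.
have [v hv] : exists v, c = 2 * v - b - d by exists (a - e); lia.
have [u hu] : exists u, a = 2 * u - b - d by exists (c - f); lia.
have : 4 * (u ^+ 2 + v ^+ 2 - u * v - (u + v) * (b + d) + (b + d) ^+ 2) = 1 :> int.
  by rewrite -[RHS]N1 hv hu /qnorm; ring.
lia.
Qed.

End Reduction.

(** * Homographies and antiholomorphic isometries *)

Section Moves.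
Local Open Scope complex_scope.
Variable R : realType.
Implicit Types (M N : 'M[R]_2) (f g : hplane R -> hplane R) (z : hplane R).

Definition cj (e : bool) (w : R[i]) : R[i] := if e then w^* else w.

(** For e = true, f is z |-> M(conj z); an orientation-reversing isometry is
    of this kind, with a real matrix M of determinant -1.  For e = false this
    is [homography]. *)
Definition moves (e : bool) M f : Prop :=
  forall z, hval (f z) = ((M 0 0)%:C * cj e (hval z) + (M 0 1)%:C)
                         / ((M 1 0)%:C * cj e (hval z) + (M 1 1)%:C).

Lemma cj_frac e (a b c d : R) (w : R[i]) :
  cj e ((a%:C * w + b%:C) / (c%:C * w + d%:C)) =
  (a%:C * cj e w + b%:C) / (c%:C * cj e w + d%:C).
Proof.
case: e => //=; rewrite rmorphM /= conjc_inv !rmorphD !rmorphM /= !oppr0.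
by [].
Qed.

Lemma cj_cj e e' w : cj e (cj e' w) = cj (e (+) e') w.
Proof. by case: e; case: e' => //=; rewrite conjcK. Qed.

Lemma den_neq0 e M z : \det M != 0 ->
  (M 1 0)%:C * cj e (hval z) + (M 1 1)%:C != 0.
Proof.
rewrite det_mx22; case: z => [[x y] /= y0]; apply: contra => /eqP h.
have [hr hi] : M 1 0 * x + M 1 1 = 0 /\ M 1 0 * y = 0.
  move: h; case: e => /= /eqP; rewrite eq_complex /= => /andP[/eqP hr /eqP hi];
  split; lra.
have c0 : M 1 0 = 0 by move/eqP: hi; rewrite mulf_eq0 (gt_eqF y0) orbF => /eqP.
by move: hr; rewrite c0 mul0r add0r => ->; rewrite !mulr0 subrr.
Qed.

Lemma moves_comp e e' M N f g : \det M != 0 -> \det N != 0 ->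
  moves e M f -> moves e' N g -> moves (e (+) e') (M * N) (f \o g).
Proof.
move=> dM dN hf hg z; rewrite hf hg /= cj_frac cj_cj.
have dMN : \det (M * N) != 0 by rewrite -mulmxE det_mulmx mulf_neq0.
have := den_neq0 (e (+) e') z dN; have := den_neq0 (e (+) e') z dMN.
move: (cj _ _) => w; rewrite !mul_mx22 !rmorphD !rmorphM /= => n1 n2.
field.
by apply/andP; split.
Qed.

Lemma moves_scale e (k : R) M f : k != 0 -> moves e M f -> moves e (k *: M) f.
Proof.
move=> k0 h z; rewrite h !scale_mxE !rmorphM /= -!mulrA -!mulrDr.
by rewrite -mulf_div divff ?mul1r // fmorph_eq0.
Qed.

Definition hpoint (x y : R) (y0 : 0 < y) : hplane R := @HPlane R (x +i* y) y0.

(** Real and imaginary part of the cross-multiplied equation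
    M(z) = N(z or conj z) at z = x + i y. *)
Lemma moves_cross e M N f : \det M != 0 -> \det N != 0 ->
  homography M f -> moves e N f ->
  forall (x y : R), 0 < y -> let s := (if e then - y else y) in
  [/\ (M 0 0 * x + M 0 1) * (N 1 0 * x + N 1 1) - M 0 0 * N 1 0 * y * s
    = (N 0 0 * x + N 0 1) * (M 1 0 * x + M 1 1) - N 0 0 * M 1 0 * y * s &
      (M 0 0 * x + M 0 1) * N 1 0 * s + (N 1 0 * x + N 1 1) * M 0 0 * y
    = (N 0 0 * x + N 0 1) * M 1 0 * y + (M 1 0 * x + M 1 1) * N 0 0 * s].
Proof.
move=> dM dN hM hN x y y0 s.
have := hN (hpoint x y0); have := hM (hpoint x y0) => ->.
have n1 := den_neq0 false (hpoint x y0) dM.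
have n2 := den_neq0 e (hpoint x y0) dN.
move/eqP; rewrite eqr_div //= => /eqP.
have -> : cj e (x +i* y) = x +i* s by rewrite /s; case: (e).
by move/eqP; rewrite eq_complex /= => /andP[/eqP h1 /eqP h2]; split; lra.
Qed.

(** Comparing the two maps at i and 2i shows that adj(N) M is scalar. *)
Lemma homography_uniq M N f : \det M = 1 -> \det N = 1 ->
  homography M f -> homography N f -> N = M \/ N = - M.
Proof.
move=> dM dN hM hN.
have n0 (A : 'M[R]_2) : \det A = 1 -> \det A != 0 by move=> ->; rewrite oner_eq0.
have h := @moves_cross false M N f (n0 _ dM) (n0 _ dN) hM hN.
have [e1 e2] := h 0 1 ltr01; have [e3 e4] := h 0 2 (ltr0n _ 2).
move: dM dN e1 e2 e3 e4 => {h hM hN}; rewrite !det_mx22 /=.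
set a := M 0 0; set b := M 0 1; set c := M 1 0; set d := M 1 1.
set a' := N 0 0; set b' := N 0 1; set c' := N 1 0; set d' := N 1 1.
move=> dM dN e1 e2 e3 e4.
have h1 : a * c' = a' * c by lra.
have h2 : b * d' = b' * d by lra.
have h3 : a * d' - b' * c = a' * d - b * c' by lra.
set s := a * d' - b' * c in h3.
have expand u : u = u * (a' * d' - b' * c') by rewrite dN mulr1.
have ha : a = a' * s.
  have -> : a' * s = a' * (a * d') - b' * (a' * c) by rewrite /s; ring.
  by rewrite -h1 {1}[a]expand; ring.
have hb : b = b' * s.
  have -> : b' * s = a' * (b' * d) - b' * (b * c') by rewrite h3; ring.
  by rewrite -h2 {1}[b]expand; ring.
have hc : c = c' * s.
  have -> : c' * s = d' * (a * c') - b' * c * c' by rewrite /s; ring.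
  by rewrite h1 {1}[c]expand; ring.
have hd : d = d' * s.
  have -> : d' * s = d * (a' * d') - c' * (b * d') by rewrite h3; ring.
  by rewrite h2 {1}[d]expand; ring.
have s2 : s ^+ 2 = 1.
  have : a * d - b * c = s ^+ 2 * (a' * d' - b' * c').
    by move: ha hb hc hd; clearbody s => -> -> -> ->; ring.
  by rewrite dM dN mulr1.
have /orP[/eqP s1|/eqP s1] : (s == 1) || (s == -1) by rewrite -sqrf_eq1 s2.
- by left; apply: eq_mx22; rewrite -/a -/b -/c -/d ?ha ?hb ?hc ?hd s1 mulr1.
- by right; apply: eq_mx22; rewrite !opp_mxE -/a -/b -/c -/d ?ha ?hb ?hc ?hd s1
    mulrN1 opprK.
Qed.

(** Comparing the two maps at i, 2i and 1 + i makes the top row of M vanish. *)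
Lemma homography_not_anti M N f : \det M = 1 -> \det N = -1 ->
  homography M f -> moves true N f -> False.
Proof.
move=> dM dN hM hN.
have nM : \det M != 0 by rewrite dM oner_eq0.
have nN : \det N != 0 by rewrite dN oppr_eq0 oner_eq0.
have h := moves_cross nM nN hM hN.
have [e1 e2] := h 0 1 ltr01; have [e3 e4] := h 0 2 (ltr0n _ 2).
have [e5 e6] := h 1 1 ltr01.
move: dM dN e1 e2 e3 e4 e5 e6 => {h hM hN}; rewrite !det_mx22 /=.
set a := M 0 0; set b := M 0 1; set c := M 1 0; set d := M 1 1.
set a' := N 0 0; set b' := N 0 1; set c' := N 1 0; set d' := N 1 1.
move=> dM dN e1 e2 e3 e4 e5 e6.
have h1 : a * c' = a' * c by lra.
have h2 : b * d' = b' * d by lra.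
have h3 : a * d' = b' * c by lra.
have h4 : a' * d = b * c' by lra.
have expand u : u = - (u * (a' * d' - b' * c')) by rewrite dN mulrN1 opprK.
have a0 : a = 0.
  have -> : a = b' * (a * c') - a' * (a * d') by rewrite {1}[a]expand; ring.
  by rewrite h1 h3; ring.
have b0 : b = 0.
  have -> : b = b' * (b * c') - a' * (b * d') by rewrite {1}[b]expand; ring.
  by rewrite h2 -h4; ring.
by move: dM => /eqP; rewrite a0 b0 !mul0r subrr eq_sym oner_eq0.
Qed.

End Moves.

(** * The length of a hyperbolic isometry *)

Section Length.
Variable R : realType.
Implicit Types (M N : 'M[R]_2) (f g : hplane R -> hplane R) (z : hplane R).

Lemma arcosh_lt (x y : R) : 1 <= x -> x < y -> arcosh x < arcosh y.
Proof.
move=> x1 xy; have y1 : 1 < y by lra.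
have s0 (t : R) : 0 <= Num.sqrt t by rewrite sqrtr_ge0.
rewrite /arcosh ltr_ln ?posrE; first last.
- have := s0 (y ^+ 2 - 1); lra.
- have := s0 (x ^+ 2 - 1); lra.
by rewrite ltrD // ltr_sqrt; nra.
Qed.

Lemma arcosh_le (x y : R) : 1 <= x -> x <= y -> arcosh x <= arcosh y.
Proof.
by move=> x1; rewrite le_eqVlt => /orP[/eqP->//|xy]; rewrite ltW // arcosh_lt.
Qed.

(** cosh(2u) = 2 cosh(u)^2 - 1. *)
Lemma arcosh_double (x : R) : 1 <= x -> arcosh (2 * x ^+ 2 - 1) = 2 * arcosh x.
Proof.
move=> x1; rewrite /arcosh; set s := Num.sqrt (x ^+ 2 - 1).
have s0 : 0 <= s by rewrite sqrtr_ge0.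
have s2 : s ^+ 2 = x ^+ 2 - 1 by rewrite sqr_sqrtr //; nra.
have -> : (2 * x ^+ 2 - 1) ^+ 2 - 1 = (2 * x * s) ^+ 2.
  by rewrite !exprMn s2; ring.
rewrite sqrtr_sqr ger0_norm; last by rewrite !mulr_ge0 //; lra.
have -> : 2 * x ^+ 2 - 1 + 2 * x * s = (x + s) * (x + s).
  have -> : (x + s) * (x + s) = x ^+ 2 + s ^+ 2 + 2 * x * s by ring.
  by rewrite s2; ring.
rewrite lnM ?posrE; lra.
Qed.

(** With M = (a b; c d), the displacement at z depends on
    |c z^2 + (d - a) z - b|^2, which equals
    (c |z|^2 + (d - a) x - b)^2 + y^2 (tr(M)^2 - 4). *)
Lemma hdist_homography M f z : \det M = 1 -> homography M f ->
  let x := complex.Re (hval z) in let y := complex.Im (hval z) in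
  hdist z (f z) = arcosh ((\tr M ^+ 2) / 2 - 1 +
    (M 1 0 * (x ^+ 2 + y ^+ 2) + (M 1 1 - M 0 0) * x - M 0 1) ^+ 2
      / (2 * y ^+ 2)).
Proof.
move=> dM hM; rewrite /hdist mxtr22.
have := @den_neq0 R false M z; rewrite dM oner_eq0 => /(_ isT).
move: dM; rewrite hM det_mx22; case: z => [[x y] /= y0].
set a := M 0 0; set b := M 0 1; set c := M 1 0; set d := M 1 1.
move=> dM nz.
have E0 : (c * x + d) ^+ 2 + (c * y) ^+ 2 != 0.
  apply: contra nz; rewrite paddr_eq0 ?sqr_ge0 // !sqrf_eq0 => /andP[/eqP h1 /eqP h2].
  by rewrite eq_complex /=; apply/andP; split; apply/eqP; lra.
rewrite sqr_sqrtr ?addr_ge0 ?sqr_ge0 //; congr arcosh.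
rewrite !mul0r !subr0 !addr0.
have -> : (a * x + b) * - (c * y / ((c * x + d) ^+ 2 + (c * y) ^+ 2))
    + a * y * ((c * x + d) / ((c * x + d) ^+ 2 + (c * y) ^+ 2))
    = y * (a * d - b * c) / ((c * x + d) ^+ 2 + (c * y) ^+ 2) by ring.
have -> : (a * x + b) * ((c * x + d) / ((c * x + d) ^+ 2 + (c * y) ^+ 2))
    - a * y * - (c * y / ((c * x + d) ^+ 2 + (c * y) ^+ 2))
    = ((a * x + b) * (c * x + d) + a * c * y ^+ 2)
       / ((c * x + d) ^+ 2 + (c * y) ^+ 2) by ring.
set P := (a * x + b) * (c * x + d) + a * c * y ^+ 2.
have -> : (x - P / ((c * x + d) ^+ 2 + (c * y) ^+ 2)) ^+ 2 +
    (y - y * (a * d - b * c) / ((c * x + d) ^+ 2 + (c * y) ^+ 2)) ^+ 2 =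
    ((x ^+ 2 + y ^+ 2) * ((c * x + d) ^+ 2 + (c * y) ^+ 2) - 2 * x * P
     - 2 * y ^+ 2 * (a * d - b * c) + (a * x + b) ^+ 2 + (a * y) ^+ 2)
    / ((c * x + d) ^+ 2 + (c * y) ^+ 2).
  by rewrite /P; field.
have -> : (x ^+ 2 + y ^+ 2) * ((c * x + d) ^+ 2 + (c * y) ^+ 2) - 2 * x * P
     - 2 * y ^+ 2 * (a * d - b * c) + (a * x + b) ^+ 2 + (a * y) ^+ 2 =
    (a + d) ^+ 2 * y ^+ 2 - 4 * y ^+ 2 * (a * d - b * c)
    + (c * (x ^+ 2 + y ^+ 2) + (d - a) * x - b) ^+ 2.
  by rewrite /P; ring.
rewrite dM; field.
by rewrite E0 gt_eqF.
Qed.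

(** The displacement is smallest on the axis c |z|^2 + (d - a) x - b = 0. *)
Lemma len_homography M f : \det M = 1 -> homography M f -> 2 < `|\tr M| ->
  len f = 2 * arcosh (`|\tr M| / 2).
Proof.
move=> dM hM t2; rewrite -arcosh_double; last by lra.
have -> : 2 * (`|\tr M| / 2) ^+ 2 - 1 = \tr M ^+ 2 / 2 - 1.
  by rewrite expr_div_n real_normK ?num_real //; field.
have t4 : 4 < \tr M ^+ 2.
  by rewrite -real_normK ?num_real //; nra.
have lb x : arcosh (\tr M ^+ 2 / 2 - 1) <= hdist x (f x).
  rewrite (hdist_homography _ dM hM); apply: arcosh_le; first by lra.
  by rewrite lerDl divr_ge0 ?sqr_ge0 // mulr_ge0 ?sqr_ge0.
have [z hz] : exists z, hdist z (f z) = arcosh (\tr M ^+ 2 / 2 - 1).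
  suff [x [y [y0 h0]]] : exists x y : R, 0 < y /\
      M 1 0 * (x ^+ 2 + y ^+ 2) + (M 1 1 - M 0 0) * x - M 0 1 = 0.
    exists (hpoint x y0); rewrite (hdist_homography _ dM hM) /= h0.
    by rewrite expr0n mul0r addr0.
  have disc : (M 1 1 - M 0 0) ^+ 2 + 4 * M 0 1 * M 1 0 = \tr M ^+ 2 - 4.
    have -> : \tr M ^+ 2 - 4 = \tr M ^+ 2 - 4 * \det M by rewrite dM mulr1.
    by rewrite det_mx22 mxtr22; ring.
  (* The axis is a vertical line when c = 0; otherwise z is its top point. *)
  have [c0|c0] := eqVneq (M 1 0) 0.
  - exists (M 0 1 / (M 1 1 - M 0 0)), 1; split => //.
    rewrite c0 mul0r add0r mulrC divfK ?subrr //.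
    apply/eqP => h; move: disc; rewrite c0 h; nra.
  - exists (- (M 1 1 - M 0 0) / (2 * M 1 0)).
    exists (Num.sqrt (\tr M ^+ 2 - 4) / (2 * `|M 1 0|)); split.
      by rewrite divr_gt0 ?sqrtr_gt0 ?mulr_gt0 ?normr_gt0 //; lra.
    rewrite [(_ / (2 * `|_|)) ^+ 2]expr_div_n sqr_sqrtr; last by lra.
    by rewrite [(2 * `|_|) ^+ 2]exprMn real_normK ?num_real // -disc; field.
apply/eqP; rewrite eq_le; apply/andP; split.
- rewrite /len -hz; apply: ge_inf; last by exists z.
  by exists (arcosh (\tr M ^+ 2 / 2 - 1)) => _ [x _ <-].
- by apply: lb_le_inf; [exists (hdist z (f z)), z | move=> _ [x _ <-]].
Qed.

End Length.

(** * Reflection matrices and angles *)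

Section Reflections.
Local Open Scope complex_scope.
Local Notation normc := ComplexField.Normc.normc.
Variable R : realType.
Implicit Types (M N : 'M[R]_2) (f g : hplane R -> hplane R) (P Q S z : hplane R).

Definition rx P : R := complex.Re (hval P).
Definition iy P : R := complex.Im (hval P).
(** The geodesic through P and Q is a |z|^2 - 2 b Re z + c = 0, vertical lines
    being the case a = 0; [geo_disc] is b^2 - a c. *)
Definition geo_a P Q : R := 2 * (rx Q - rx P).
Definition geo_b P Q : R := rx Q ^+ 2 + iy Q ^+ 2 - rx P ^+ 2 - iy P ^+ 2.
Definition geo_c P Q : R := 2 * geo_b P Q * rx P - geo_a P Q * (rx P ^+ 2 + iy P ^+ 2).
Definition geo_disc P Q : R :=
  (geo_a P Q * iy P) ^+ 2 + (geo_b P Q - geo_a P Q * rx P) ^+ 2.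

(** The sign makes [refl_mx] antisymmetric in P and Q, which fixes the signs of
    the traces of products of reflections in the sides of a triangle. *)
Definition refl_mx P Q : 'M[R]_2 :=
  (Num.sqrt (geo_disc P Q))^-1 *:
    mat2 (geo_b P Q) (- geo_c P Q) (geo_a P Q) (- geo_b P Q).

Lemma iy_gt0 P : 0 < iy P. Proof. exact: hval_gt0. Qed.

Lemma geo_discE P Q : geo_disc P Q = geo_b P Q ^+ 2 - geo_a P Q * geo_c P Q.
Proof. by rewrite /geo_disc /geo_c; ring. Qed.

Lemma geo_discC P Q : geo_disc Q P = geo_disc P Q.
Proof. by rewrite /geo_disc /geo_a /geo_b; ring. Qed.

Lemma hplane_eq P Q : rx P = rx Q -> iy P = iy Q -> P = Q.
Proof.
move=> hx hy; apply: val_inj => /=; move: hx hy; rewrite /rx /iy.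
by case: (hval P) (hval Q) => [a b] [c d] /= -> ->.
Qed.

Lemma geo_disc_gt0 P Q : P <> Q -> 0 < geo_disc P Q.
Proof.
move=> PQ; have yP := iy_gt0 P; have yQ := iy_gt0 Q.
rewrite lt_neqAle addr_ge0 ?sqr_ge0 // andbT eq_sym /geo_disc.
apply/negP; rewrite paddr_eq0 ?sqr_ge0 // !sqrf_eq0 => /andP[].
rewrite mulf_eq0 (gt_eqF yP) orbF => /eqP a0; rewrite a0 mul0r subr0 => /eqP b0.
have hx : rx P = rx Q by move: a0; rewrite /geo_a; lra.
apply: PQ; apply: hplane_eq => //.
have : (iy Q - iy P) * (iy Q + iy P) = 0.
  by move: b0; rewrite /geo_b hx => <-; ring.
move/eqP; rewrite mulf_eq0 => /orP[|] /eqP; lra.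
Qed.

Lemma refl_mx_tr P Q : \tr (refl_mx P Q) = 0.
Proof. by rewrite mxtr22 /refl_mx !scale_mxE !mat2E; ring. Qed.

Lemma sqrt_disc_neq0 P Q : P <> Q -> Num.sqrt (geo_disc P Q) != 0.
Proof. by move=> /geo_disc_gt0 h; rewrite gt_eqF // sqrtr_gt0. Qed.

Lemma refl_mx_det P Q : P <> Q -> \det (refl_mx P Q) = -1.
Proof.
move=> PQ; rewrite det_mx22 /refl_mx !scale_mxE !mat2E.
set s := Num.sqrt _; have s2 : s ^+ 2 = geo_disc P Q.
  by rewrite sqr_sqrtr // ltW // geo_disc_gt0.
have s0 : s != 0 by exact: sqrt_disc_neq0.
have -> : s^-1 * geo_b P Q * (s^-1 * - geo_b P Q)
   - s^-1 * - geo_c P Q * (s^-1 * geo_a P Q) = - (geo_disc P Q / s ^+ 2).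
  by rewrite geo_discE; field.
by rewrite s2 divff // gt_eqF // geo_disc_gt0.
Qed.

Lemma refl_mxC P Q : refl_mx Q P = - refl_mx P Q.
Proof.
rewrite /refl_mx geo_discC -scalerN; congr (_ *: _).
by apply: eq_mx22; rewrite opp_mxE !mat2E /geo_c /geo_a /geo_b; ring.
Qed.

Lemma moves_refl P Q : P <> Q -> moves true (refl_mx P Q) (reflection P Q).
Proof.
move=> PQ; apply: moves_scale; first by rewrite invr_eq0 sqrt_disc_neq0.
have D0 := geo_disc_gt0 PQ.
move=> z; rewrite /reflection; case: ifP => [/eqP|/negbT] hx.
- have a0 : geo_a P Q = 0 by rewrite /geo_a /rx hx; ring.
  have b0 : geo_b P Q != 0.
    by apply: contraTneq D0 => b0;
      rewrite /geo_disc a0 b0 !mul0r subr0 expr0n addr0 ltxx.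
  rewrite !mat2E a0 /geo_c a0 !mul0r subr0 add0r.
  have -> : complex.Re (hval P) = rx P by [].
  case: z => [[x y] y0]; rewrite /mirror /=.
  have b0c : (- geo_b P Q)%:C != 0 by rewrite fmorph_eq0 oppr_eq0.
  apply: (mulIf b0c); rewrite divfK //.
  by apply/eqP; rewrite eq_complex /=; apply/andP; split; apply/eqP; ring.
- have a0 : geo_a P Q != 0.
    by rewrite /geo_a mulf_neq0 ?pnatr_eq0 // subr_eq0 eq_sym.
  rewrite !mat2E /inversion /=.
  set c := geo_b P Q / geo_a P Q.
  have -> : centre P Q = c.
    rewrite /centre /c; congr (_ / _).
    case: P Q {PQ D0 hx a0 c} => [[px py] /= p0] [[qx qy] /= q0].
    rewrite !sqr_sqrtr ?addr_ge0 ?sqr_ge0 //.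
    by rewrite /geo_b /rx /iy /=; ring.
  set N := normc _ ^+ 2.
  have -> : geo_b P Q = geo_a P Q * c by rewrite /c mulrC divfK.
  have -> : - geo_c P Q = geo_a P Q * (N - c ^+ 2).
    have -> : N = (rx P - c) ^+ 2 + iy P ^+ 2.
      rewrite /N /rx /iy; case: (hval P) => [px py] /=.
      by rewrite sqr_sqrtr ?addr_ge0 ?sqr_ge0 // oppr0 addr0.
    by rewrite /geo_c /c; field.
  move: (geo_a P Q) a0 => k a0; clearbody N; clearbody c.
  have n0 : conjc (hval z) - c%:C != 0.
    case: z => [[x y] /= y0]; rewrite eq_complex /= subr0 oppr_eq0.
    by rewrite (gt_eqF y0) andbF.
  have a0C : k%:C != 0 by rewrite fmorph_eq0.
  rewrite !(rmorphM, rmorphB, rmorphN, rmorphXn) /=.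
  rewrite -[Num.conj _]/(conjc (hval z)).
  move: (conjc _) n0 => w n0.
  by field; apply/andP; split; rewrite -?mulrBr ?mulf_neq0.
Qed.

(** The tangent direction at P is a positive multiple of
    (a Im P, b - a Re P), of squared length [geo_disc], and the inner product
    of two such vectors is b b' - (a c' + a' c) / 2. *)
Lemma cos_angle P Q S : P <> Q -> P <> S ->
  cos (angle P Q S) = \tr (refl_mx P Q * refl_mx P S) / 2.
Proof.
move=> PQ PS.
have dirE X : P <> X -> exists k : R, 0 < k /\ direction P X =
    (k * (geo_a P X * iy P)) +i* (k * (geo_b P X - geo_a P X * rx P)).
  move=> PX; rewrite /direction; case: ifP => [/eqP|/negbT] hx.
  - have y0 : 0 < iy P + iy X by rewrite addr_gt0 ?iy_gt0.
    exists (iy P + iy X)^-1; split; first by rewrite invr_gt0.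
    have hx' : rx X = rx P by [].
    rewrite /geo_a /geo_b hx' subrr !mulr0 !mul0r mulr0 subr0.
    congr (_ +i* _); rewrite -/(iy P) -/(iy X); field.
    by rewrite gt_eqF.
  - exists (1 / 2); split; first by lra.
    have a0 : geo_a P X != 0.
      by rewrite /geo_a mulf_neq0 ?pnatr_eq0 // subr_eq0 eq_sym.
    have cE : centre P X = geo_b P X / geo_a P X.
      rewrite /centre; congr (_ / _).
      case: P X {PQ PS PX hx a0} => [[px py] /= p0] [[qx qy] /= q0].
      rewrite !sqr_sqrtr ?addr_ge0 ?sqr_ge0 //.
      by rewrite /geo_b /rx /iy /=; ring.
    rewrite cE; apply/eqP; rewrite eq_complex /=; apply/andP; split; apply/eqP.
      by rewrite mul0r subr0 /geo_a -/(iy P) -/(rx P) -/(rx X); field.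
    rewrite -/(iy P) -/(rx P) -/(rx X) !mul0r addr0.
    have -> : rx X - rx P = geo_a P X / 2 by rewrite /geo_a; field.
    by field.
have [k [k0 hk]] := dirE Q PQ; have [l [l0 hl]] := dirE S PS.
rewrite /angle hk hl /=.
set dQ := Num.sqrt (geo_disc P Q); set dS := Num.sqrt (geo_disc P S).
have dQ0 : 0 < dQ by rewrite sqrtr_gt0 geo_disc_gt0.
have dS0 : 0 < dS by rewrite sqrtr_gt0 geo_disc_gt0.
have -> : Num.sqrt ((k * (geo_a P Q * iy P)) ^+ 2
    + (k * (geo_b P Q - geo_a P Q * rx P)) ^+ 2) = k * dQ.
  rewrite !exprMn -mulrDr sqrtrM ?sqr_ge0 // sqrtr_sqr gtr0_norm //.
  by rewrite /dQ /geo_disc !exprMn.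
have -> : Num.sqrt ((l * (geo_a P S * iy P)) ^+ 2
    + (l * (geo_b P S - geo_a P S * rx P)) ^+ 2) = l * dS.
  rewrite !exprMn -mulrDr sqrtrM ?sqr_ge0 // sqrtr_sqr gtr0_norm //.
  by rewrite /dS /geo_disc !exprMn.
set t := (_ / (k * dQ * (l * dS))).
have -> : \tr (refl_mx P Q * refl_mx P S) / 2 = t.
  rewrite mxtr22 !mul_mx22 /refl_mx !scale_mxE !mat2E -/dQ -/dS /t /geo_c.
  by field; rewrite !gt_eqF.
rewrite acosK //.
have dQ2 : dQ ^+ 2 = geo_disc P Q by rewrite sqr_sqrtr // ltW // geo_disc_gt0.
have dS2 : dS ^+ 2 = geo_disc P S by rewrite sqr_sqrtr // ltW // geo_disc_gt0.
(* Cauchy-Schwarz keeps the quotient in [-1, 1]. *)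
have tE : t * (dQ * dS) = geo_a P Q * iy P * (geo_a P S * iy P) +
    (geo_b P Q - geo_a P Q * rx P) * (geo_b P S - geo_a P S * rx P).
  by rewrite /t; field; rewrite !gt_eqF.
have t1 : t ^+ 2 <= 1.
  have h : 0 < dQ ^+ 2 * dS ^+ 2 by rewrite mulr_gt0 ?exprn_gt0.
  rewrite -(ler_pM2r h) mul1r -exprMn -exprMn tE exprMn dQ2 dS2 -subr_ge0.
  rewrite /geo_disc; move: (geo_a P Q * iy P) (geo_a P S * iy P) => p r.
  move: (geo_b P Q - geo_a P Q * rx P) (geo_b P S - geo_a P S * rx P) => u v.
  have -> : (p ^+ 2 + u ^+ 2) * (r ^+ 2 + v ^+ 2) - (p * r + u * v) ^+ 2
    = (p * v - u * r) ^+ 2 by ring.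
  by rewrite sqr_ge0.
by rewrite in_itv /=; apply/andP; split; nra.
Qed.

(** c = cos(pi/3) satisfies 4c^3 - 3c = -1, that is (c + 1)(2c - 1)^2 = 0. *)
Lemma cos_pi3 : cos (pi / 3) = 1 / 2 :> R.
Proof.
have pi0 := pi_gt0 R.
set x := pi / 3; have c0 : 0 < cos x by apply: cos_gt0_pihalf; rewrite /x; lra.
have : cos (x + x *+ 2) = -1.
  by rewrite (_ : x + x *+ 2 = pi) ?cospi // /x; field.
rewrite cosD cos_mulr2n sin_mulr2n => h.
have s2 := sin2cos2 x.
have : (cos x + 1) * (2 * cos x - 1) ^+ 2 = 0.
  have -> : (cos x + 1) * (2 * cos x - 1) ^+ 2 =
    cos x * (cos x ^+ 2 *+ 2 - 1) - (cos x * (1 - cos x ^+ 2)) *+ 2 + 1 by ring.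
  rewrite -s2.
  have -> : cos x * sin x ^+ 2 *+ 2 = sin x * (cos x * sin x *+ 2) by ring.
  by rewrite h addNr.
move/eqP; rewrite mulf_eq0 sqrf_eq0 => /orP[|] /eqP; lra.
Qed.

(** c = cos(pi/5) satisfies cos(5x) = -1 in the form
    (c + 1)(4c^2 - 2c - 1)^2 = 0. *)
Lemma two_cos_pi5 : let l := 2 * cos (pi / 5) in 0 < l /\ l ^+ 2 = l + 1 :> R.
Proof.
have pi0 := pi_gt0 R.
set x := pi / 5; have c0 : 0 < cos x by apply: cos_gt0_pihalf; rewrite /x; lra.
split; first by lra.
have : cos (x *+ 2 + (x + x *+ 2)) = -1.
  by rewrite (_ : x *+ 2 + (x + x *+ 2) = pi) ?cospi // /x; field.
rewrite mulr2n !(cosD, sinD) => h.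
have : (cos x + 1) * (4 * cos x ^+ 2 - 2 * cos x - 1) ^+ 2 = 0.
  move: (sin2cos2 x) h c0; move: (cos x) (sin x) => c s s2 h c0.
  have quintic : c ^+ 5 - 10 * c ^+ 3 * s ^+ 2 + 5 * c * (s ^+ 2) ^+ 2 = -1.
    by rewrite -h; ring.
  transitivity (c ^+ 5 - 10 * c ^+ 3 * s ^+ 2 + 5 * c * (s ^+ 2) ^+ 2 + 1).
    by rewrite s2; ring.
  by rewrite quintic addNr.
move/eqP; rewrite mulf_eq0 sqrf_eq0 => /orP[|] /eqP; nra.
Qed.

Lemma two_cos_pi6 : let l := 2 * cos (pi / 6) in 0 < l /\ l ^+ 2 = 3 :> R.
Proof.
have pi0 := pi_gt0 R.
set x := pi / 6; have c0 : 0 < cos x by apply: cos_gt0_pihalf; rewrite /x; lra.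
split; first by lra.
have : cos (x + x *+ 2) = 0.
  by rewrite (_ : x + x *+ 2 = pi / 2) ?cos_pihalf // /x; field.
rewrite cosD cos_mulr2n sin_mulr2n => h.
have s2 := sin2cos2 x.
have : cos x * (4 * cos x ^+ 2 - 3) = 0.
  rewrite -[RHS]h.
  have -> : sin x * (cos x * sin x *+ 2) = cos x * sin x ^+ 2 *+ 2 by ring.
  by rewrite s2; ring.
move/eqP; rewrite mulf_eq0 (gt_eqF c0) /= => /eqP; lra.
Qed.

End Reflections.

(** * The group generated by three reflections *)

Section Group.
Variable R : realType.
Variable lam : R.
Variables (r1 r2 r3 : hplane R -> hplane R) (R1 R2 R3 : 'M[R]_2).
Hypotheses (m1 : moves true R1 r1) (m2 : moves true R2 r2) (m3 : moves true R3 r3).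
Hypotheses (tr1 : \tr R1 = 0) (tr2 : \tr R2 = 0) (tr3 : \tr R3 = 0).
Hypotheses (dr1 : \det R1 = -1) (dr2 : \det R2 = -1) (dr3 : \det R3 = -1).
Hypotheses (tr12 : \tr (R1 * R2) = -1) (tr13 : \tr (R1 * R3) = -1).
Hypothesis (tr23 : \tr (R2 * R3) = - lam).

Let sq1 : R1 * R1 = 1. Proof. exact: traceless_sq. Qed.
Let sq2 : R2 * R2 = 1. Proof. exact: traceless_sq. Qed.
Let sq3 : R3 * R3 = 1. Proof. exact: traceless_sq. Qed.

Let G : set (hplane R -> hplane R) :=
  [set f | generated [set r1; r2; r3] f /\ orientation_preserving f].

(** An odd word in the reflections is R1 times an even one. *)
Definition lattice_mx (e : bool) (a b c d : {poly int}) : 'M[R]_2 :=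
  (if e then R1 else 1) *
    qelt R1 R2 R3 (ev lam a) (ev lam b) (ev lam c) (ev lam d).

(** The coordinates have norm 1 as polynomials, hence after every
    specialization of the variable. *)
Definition lattice_map (f : hplane R -> hplane R) : Prop :=
  exists e a b c d, [/\ qnorm 'X a b c d = 1,
    \det (lattice_mx e a b c d) = (-1) ^+ e & moves e (lattice_mx e a b c d) f].

Lemma lattice_map_refl r Rr f : moves true Rr r -> \det Rr = -1 ->
  (forall e a b c d, exists a' b' c' d',
     qnorm 'X a' b' c' d' = qnorm 'X a b c d /\
     Rr * lattice_mx e a b c d = lattice_mx (~~ e) a' b' c' d') ->
  lattice_map f -> lattice_map (r \o f).
Proof.
move=> mr dr H [e [a [b [c [d [N1 De mf]]]]]].
have [a' [b' [c' [d' [N' E]]]]] := H e a b c d.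
exists (~~ e), a', b', c', d'; rewrite -E; split.
- by rewrite N'.
- by rewrite -mulmxE det_mulmx dr De; case: (e);
    rewrite ?expr0 ?expr1 ?mulr1 ?mulrNN ?mulr1.
- apply: (@moves_comp _ true e) => //; first by rewrite dr oppr_eq0 oner_eq0.
  by rewrite De signr_eq0.
Qed.

Lemma lattice_map1 f : lattice_map f -> lattice_map (r1 \o f).
Proof.
apply: (lattice_map_refl m1 dr1) => e a b c d; exists a, b, c, d; split => //.
by rewrite /lattice_mx; case: e; rewrite mulrA ?sq1 ?mulr1.
Qed.

Lemma lattice_map2 f : lattice_map f -> lattice_map (r2 \o f).
Proof.
apply: (lattice_map_refl m2 dr2) => -[] a b c d.
- exists (b - a), (- a), (- d), (c - d); rewrite qnorm21; split => //.
  rewrite /lattice_mx /= mul1r mulrA !evE.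
  exact: (mul_qelt21).
- exists (- b), (a - b), (d - c), (- c); rewrite qnorm12; split => //.
  rewrite /lattice_mx /= mul1r !evE.
  by rewrite -mul_qelt12 // !mulrA sq1 mul1r.
Qed.

Lemma lattice_map3 f : lattice_map f -> lattice_map (r3 \o f).
Proof.
apply: (lattice_map_refl m3 dr3) => -[] a b c d.
- exists (c - a - 'X * b), d, ('X * d - a), (- b - d); rewrite qnorm31; split => //.
  rewrite /lattice_mx /= mul1r mulrA !evE.
  exact: (mul_qelt31 (l := lam)).
- exists ('X * b - c), (- b - d), (a - c - 'X * d), b; rewrite qnorm13; split => //.
  rewrite /lattice_mx /= mul1r !evE.
  by rewrite -(mul_qelt13 (l := lam)) // !mulrA sq1 mul1r.
Qed.

Lemma moves_involutive (Rr : 'M[R]_2) (r : hplane R -> hplane R) :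
  \det Rr = -1 -> Rr * Rr = 1 -> moves true Rr r ->
  involutive r.
Proof.
move=> dr sr mr z; apply: val_inj => /=.
have d0 : \det Rr != 0 by rewrite dr oppr_eq0 oner_eq0.
have := moves_comp d0 d0 mr mr z; rewrite sr /= => ->.
by rewrite !one_mxE /= mul1r mul0r add0r addr0 divr1.
Qed.

Lemma lattice_map_id : lattice_map id.
Proof.
exists false, 1, 0, 0, 0.
have E : lattice_mx false 1 0 0 0 = 1.
  rewrite /lattice_mx /qelt mul1r ev1.
  have -> : ev lam 0 = 0 by rewrite (evC lam 0).
  by rewrite !scale0r !addr0.
rewrite E expr0; split; first by rewrite /qnorm; ring.
  by rewrite det1.
by move=> z; rewrite !one_mxE /= mul1r mul0r add0r addr0 divr1.
Qed.

(** The class of [lattice_map] is stable under composition on the left with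
    each generator, and the generators are their own inverses; so it is stable
    under each generated map and under its inverse. *)
Lemma generated_lattice f : generated [set r1; r2; r3] f -> lattice_map f.
Proof.
suff H : generated [set r1; r2; r3] f -> exists f', [/\ cancel f f', cancel f' f,
    forall g, lattice_map g -> lattice_map (f \o g) &
    forall g, lattice_map g -> lattice_map (f' \o g)].
  by move=> /H[f' [_ _ h _]]; exact: (h _ lattice_map_id).
elim=> [{}f /= [[|]|] ->| |{}f g _ [f' [f1 f2 f3 f4]] _ [g' [g1 g2 g3 g4]]
       |{}f g _ [f' [f1 f2 f3 f4]] fg gf].
- by exists r1; split; [exact: (moves_involutive dr1 sq1 m1)..|exact: lattice_map1|
    exact: lattice_map1].
- by exists r2; split; [exact: (moves_involutive dr2 sq2 m2)..|exact: lattice_map2|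
    exact: lattice_map2].
- by exists r3; split; [exact: (moves_involutive dr3 sq3 m3)..|exact: lattice_map3|
    exact: lattice_map3].
- by exists id; split.
- exists (g' \o f'); split; [exact: can_comp|exact: can_comp| |].
  + by move=> h /g3/f3.
  + by move=> h /f4/g4.
- have -> : g = f' by apply/funext => z; rewrite -{1}[z]f2 fg.
  by exists f; split.
Qed.

Lemma triangle_lattice f : G f -> exists a b c d,
  let K := qelt R1 R2 R3 (ev lam a) (ev lam b) (ev lam c) (ev lam d) in
  [/\ qnorm 'X a b c d = 1, \det K = 1 & homography K f].
Proof.
case=> /generated_lattice[e [a [b [c [d [N1 De mf]]]]]] [M dM hM].
case: e De mf => De mf.
  by case: (homography_not_anti dM De hM mf).
by exists a, b, c, d; move: De mf; rewrite /lattice_mx mul1r; split.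
Qed.

Lemma moves_refl2 (Rr Rs : 'M[R]_2) (r s : hplane R -> hplane R) :
  \det Rr = -1 -> \det Rs = -1 -> moves true Rr r -> moves true Rs s ->
  \det (Rr * Rs) = 1 /\ homography (Rr * Rs) (r \o s).
Proof.
move=> dr ds mr ms; have n0 : (-1 : R) != 0 by rewrite oppr_eq0 oner_eq0.
split; first by rewrite -mulmxE det_mulmx dr ds mulrNN mulr1.
by apply: (@moves_comp _ true true) => //; rewrite ?dr ?ds.
Qed.

Lemma homography_comp (M N : 'M[R]_2) (f g : hplane R -> hplane R) :
  \det M = 1 /\ homography M f -> \det N = 1 /\ homography N g ->
  \det (M * N) = 1 /\ homography (M * N) (f \o g).
Proof.
move=> [dM hM] [dN hN]; split; first by rewrite -mulmxE det_mulmx dM dN mulr1.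
by apply: (@moves_comp _ false false) => //; rewrite ?dM ?dN oner_eq0.
Qed.

Definition first_map := (r1 \o r2) \o (r1 \o r3).
Definition second_map := (((r1 \o r3) \o (r2 \o r1)) \o (r1 \o r3)) \o (r1 \o r2).
Definition second_inv := (((r2 \o r1) \o (r3 \o r1)) \o (r1 \o r2)) \o (r3 \o r1).
Definition second_inv_elt := R2 * R1 * (R3 * R1) * (R1 * R2) * (R3 * R1).

Let h12 := moves_refl2 dr1 dr2 m1 m2.
Let h13 := moves_refl2 dr1 dr3 m1 m3.
Let h21 := moves_refl2 dr2 dr1 m2 m1.
Let h31 := moves_refl2 dr3 dr1 m3 m1.

Lemma first_mapP : \det (first_elt R1 R2 R3) = 1 /\
  homography (first_elt R1 R2 R3) first_map.
Proof. exact: homography_comp h12 h13. Qed.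

Lemma second_mapP : \det (second_elt R1 R2 R3) = 1 /\
  homography (second_elt R1 R2 R3) second_map.
Proof.
exact: homography_comp (homography_comp (homography_comp h13 h21) h13) h12.
Qed.

Lemma second_invP : \det second_inv_elt = 1 /\
  homography second_inv_elt second_inv.
Proof.
exact: homography_comp (homography_comp (homography_comp h21 h31) h12) h31.
Qed.

Lemma second_eltK : second_elt R1 R2 R3 * second_inv_elt = 1.
Proof.
have s12 : R1 * R2 * (R2 * R1) = 1 by rewrite mulrA -[R1 * R2 * R2]mulrA sq2 mulr1 sq1.
have s13 : R1 * R3 * (R3 * R1) = 1 by rewrite mulrA -[R1 * R3 * R3]mulrA sq3 mulr1 sq1.
have s21 : R2 * R1 * (R1 * R2) = 1 by rewrite mulrA -[R2 * R1 * R1]mulrA sq1 mulr1 sq2.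
rewrite /second_elt /second_inv_elt.
move: (R1 * R2) (R1 * R3) (R2 * R1) (R3 * R1) s12 s13 s21 => a b c d ac bd ca.
rewrite -!mulrA [a * (c * _)]mulrA ac mul1r [b * (d * _)]mulrA bd mul1r.
by rewrite [c * (a * _)]mulrA ca mul1r bd.
Qed.

Lemma generated_comp2 (X : set (hplane R -> hplane R)) r s :
  X r -> X s -> generated X (r \o s).
Proof. by move=> Xr Xs; apply: generated_comp; apply: generated_in. Qed.

Let X1 : [set r1; r2; r3] r1. Proof. by left; left. Qed.
Let X2 : [set r1; r2; r3] r2. Proof. by left; right. Qed.
Let X3 : [set r1; r2; r3] r3. Proof. by right. Qed.

Lemma first_map_in : G first_map.
Proof.
split; last by exists (first_elt R1 R2 R3); case: first_mapP.
by apply: generated_comp; apply: generated_comp2.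
Qed.

Lemma second_map_in : G second_map.
Proof.
split; last by exists (second_elt R1 R2 R3); case: second_mapP.
by apply: generated_comp; [apply: generated_comp; [apply: generated_comp|]|];
  apply: generated_comp2.
Qed.

Lemma second_inv_in : G second_inv.
Proof.
split; last by exists second_inv_elt; case: second_invP.
by apply: generated_comp; [apply: generated_comp; [apply: generated_comp|]|];
  apply: generated_comp2.
Qed.

End Group.

(** * Conjugating a matrix to its inverse *)

(** Cayley-Hamilton. *)
Lemma det1_inverse (K : fieldType) (M N : 'M[K]_2) : \det M = 1 -> M * N = 1 ->
  N = (\tr M)%:M - M.
Proof.
move=> dM MN; have NM : N * M = 1 by apply: mulmx1C.
have CH : M * ((\tr M)%:M - M) = 1.
  move: dM; rewrite det_mx22 mxtr22 => dM.
  apply: eq_mx22; rewrite !mx22E /= ?mulr0 ?mulr1 -?[RHS]dM; ring.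
by rewrite -[LHS]mulr1 -CH mulrA NM mul1r.
Qed.

(** Geometrically, for |tr S| > 2 and det M = 1, M exchanges the two ends of
    the axis of S, so it is a half turn about a point of this axis.  The proof
    compares two expressions for tr(MS) and for tr(SMS). *)
Lemma inverting_traceless (K : numFieldType) (S Si M : 'M[K]_2) :
  \det S = 1 -> S * Si = 1 -> \tr S != 0 -> \tr S ^+ 2 != 4 ->
  Si * M = M * S \/ Si * M = - (M * S) -> \tr M = 0 /\ \tr (S * M) = 0.
Proof.
move=> dS SSi t0 t4 H; have SiE := det1_inverse dS SSi.
have e1 : \tr (Si * M) = \tr S * \tr M - \tr (S * M).
  by rewrite SiE mulrBl raddfB /= mul_scalar_mx22 mxtraceZ.
have SS : S * S = \tr S *: S - 1.
  by rewrite -SSi SiE mulrBr mul_mx22_scalar opprB addrC subrK.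
have e2 : \tr (S * (M * S)) = \tr S * \tr (S * M) - \tr M.
  rewrite mulrA -[LHS]mxtrace_mulC mulmxE mulrA SS mulrBl mul1r -scalerAl.
  by rewrite raddfB /= mxtraceZ.
have e3 : S * (Si * M) = M by rewrite mulrA SSi mul1r.
have MS : \tr (M * S) = \tr (S * M) by rewrite -mulmxE mxtrace_mulC.
case: H => H.
- have a1 : 2 * \tr (S * M) = \tr S * \tr M.
    by rewrite mulr_natl mulr2n -{1}MS -H e1 subrK.
  have a2 : 2 * \tr M = \tr S * \tr (S * M).
    by rewrite mulr_natl mulr2n -{1}e3 H e2 subrK.
  have : (\tr S ^+ 2 - 4) * \tr M = 0.
    rewrite mulrBl expr2 -mulrA -a1 mulrCA -a2; ring.
  move/eqP; rewrite mulf_eq0 subr_eq0 (negbTE t4) /= => /eqP trM; split=> //.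
  by move/eqP: a2; rewrite trM mulr0 eq_sym mulf_eq0 (negbTE t0) => /eqP.
- have a1 : \tr S * \tr M = 0.
    by rewrite -(addrK (- \tr (S * M)) (_ * _)) -e1 H raddfN /= MS opprK addNr.
  have a2 : \tr S * \tr (S * M) = 0.
    rewrite -[LHS](subrK (\tr M)) -e2 -[X in _ + \tr X]e3 H mulrN raddfN /=.
    exact: subrr.
  by split; apply/eqP; [move/eqP: a1|move/eqP: a2]; rewrite mulf_eq0 (negbTE t0).
Qed.

(** * The length spectrum *)

Lemma two_card_le T (A : set T) (a b : T) : A a -> A b -> a <> b -> `I_2 #<= A.
Proof.
move=> Aa Ab ab; pose f (n : nat) := if n is 0%N then a else b.
have fI : {in `I_2 &, injective f}.
  move=> m n; rewrite !inE /=.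
  by case: m n => [|[|//]] [|[|//]] //= _ _ h; exfalso; apply: ab.
have := inj_card_eq fI; rewrite card_eq_le => /andP[_ h].
apply: card_le_trans h _; apply: subset_card_le => _ [[|n] _ <-] //.
Qed.

Section Spectrum.
Variable R : realType.
Variables (lam conj_lam : R).
Variables (r1 r2 r3 : hplane R -> hplane R) (R1 R2 R3 : 'M[R]_2).
Hypotheses (m1 : moves true R1 r1) (m2 : moves true R2 r2) (m3 : moves true R3 r3).
Hypotheses (tr1 : \tr R1 = 0) (tr2 : \tr R2 = 0) (tr3 : \tr R3 = 0).
Hypotheses (dr1 : \det R1 = -1) (dr2 : \det R2 = -1) (dr3 : \det R3 = -1).
Hypotheses (tr12 : \tr (R1 * R2) = -1) (tr13 : \tr (R1 * R3) = -1).
Hypothesis (tr23 : \tr (R2 * R3) = - lam).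
Hypothesis lam1 : 1 < lam.
Hypothesis lam_lt : lam + 1 < lam ^+ 2 + lam - 1.
Hypothesis conj_lam_itv : -2 <= conj_lam <= 1.
Hypothesis gap : forall P, ev conj_lam P ^+ 2 <= 4 -> 2 < ev lam P ->
  ev lam P < lam ^+ 2 + lam - 1 -> ev lam P = lam + 1.
Hypothesis no_inverting : forall a b c d, qnorm 'X a b c d = 1 ->
  ev lam (qtrace 'X a b c d) = 0 -> ev lam (qtrace2 'X a b c d) = 0 -> False.

Let G : set (hplane R -> hplane R) :=
  [set f | generated [set r1; r2; r3] f /\ orientation_preserving f].
Let tau := lam ^+ 2 + lam - 1.

Let sq1 : R1 * R1 = 1. Proof. exact: traceless_sq. Qed.
Let sq2 : R2 * R2 = 1. Proof. exact: traceless_sq. Qed.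
Let sq3 : R3 * R3 = 1. Proof. exact: traceless_sq. Qed.

(** The conjugate of the trace is bounded by [qtrace_bound], so [gap] applies
    to the trace or to its opposite. *)
Lemma len_in_group f : G f -> hyperbolic f -> exists t,
  [/\ 2 < t, t = lam + 1 \/ tau <= t & len f = 2 * arcosh (t / 2)].
Proof.
move=> Gf [M [dM hM tM]].
have [a [b [c [d [N1 dK hK]]]]] :=
  triangle_lattice m1 m2 m3 tr1 tr2 tr3 dr1 dr2 dr3 tr12 tr13 tr23 Gf.
exists `|\tr M|; split; [by []| |exact: len_homography].
have -> : `|\tr M| = `|ev lam (qtrace 'X a b c d)|.
  rewrite ev_qtrace -(trace_qelt tr12 tr13 tr23).
  by have [->|->] := homography_uniq dM dK hM hK; rewrite ?raddfN /= ?normrN.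
have tK : 2 < `|ev lam (qtrace 'X a b c d)|.
  rewrite ev_qtrace -(trace_qelt tr12 tr13 tr23).
  by have [->|->] := homography_uniq dM dK hM hK; rewrite ?raddfN /= ?normrN.
have bound : ev conj_lam (qtrace 'X a b c d) ^+ 2 <= 4.
  rewrite ev_qtrace; apply: qtrace_bound => //.
  by rewrite -ev_qnorm N1 ev1.
move: (qtrace _ _ _ _ _) tK bound => P tP bP.
have [|lt] := leP tau `|ev lam P|; first by right.
left; have [P0|P0] := ger0P (ev lam P).
  by rewrite ger0_norm // in tP lt *; apply: gap.
rewrite ltr0_norm // -evN in tP lt *; apply: gap => //.
by rewrite evN sqrrN.
Qed.

Lemma first_len : hyperbolic (first_map r1 r2 r3) /\
  len (first_map r1 r2 r3) = 2 * arcosh ((lam + 1) / 2).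
Proof.
have [d h] := first_mapP m1 m2 m3 dr1 dr2 dr3.
have t : `|\tr (first_elt R1 R2 R3)| = lam + 1.
  have l0 : 0 < lam + 1 by move: lam1; lra.
  by rewrite (trace_first_elt sq1 tr1 tr2 tr12 tr13 tr23) gtr0_norm.
split; first by exists (first_elt R1 R2 R3); rewrite t; split => //; move: lam1; lra.
by rewrite (len_homography d h) t //; move: lam1; lra.
Qed.

Lemma second_tr : `|\tr (second_elt R1 R2 R3)| = tau.
Proof.
rewrite (trace_second_elt sq1 sq2 sq3 tr1 tr2 tr3 tr12 tr13 tr23) ltr0_norm.
  by rewrite /tau; ring.
by move: lam1 lam_lt; lra.
Qed.

Lemma second_len : hyperbolic (second_map r1 r2 r3) /\
  len (second_map r1 r2 r3) = 2 * arcosh (tau / 2).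
Proof.
have [d h] := second_mapP m1 m2 m3 dr1 dr2 dr3.
have t2 : 2 < tau by move: lam1 lam_lt; rewrite /tau; lra.
split; first by exists (second_elt R1 R2 R3); rewrite second_tr; split.
by rewrite (len_homography d h) second_tr.
Qed.

Lemma second_inv_tr : \tr (second_inv_elt R1 R2 R3) = \tr (second_elt R1 R2 R3).
Proof.
have [d h] := second_mapP m1 m2 m3 dr1 dr2 dr3.
rewrite (det1_inverse d (second_eltK tr1 tr2 tr3 dr1 dr2 dr3)).
by rewrite raddfB /= mxtrace_scalar mulr2n addrK.
Qed.

Lemma second_inv_len : hyperbolic (second_inv r1 r2 r3) /\
  len (second_inv r1 r2 r3) = 2 * arcosh (tau / 2).
Proof.
have [d h] := second_invP m1 m2 m3 dr1 dr2 dr3.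
have t2 : 2 < tau by move: lam1 lam_lt; rewrite /tau; lra.
split.
  by exists (second_inv_elt R1 R2 R3); rewrite second_inv_tr second_tr; split.
by rewrite (len_homography d h) second_inv_tr second_tr.
Qed.

Lemma id_in : G id.
Proof.
split; first exact: generated_id.
exists 1; first by rewrite det1.
by move=> z; rewrite !one_mxE /= mul1r mul0r add0r addr0 divr1.
Qed.

(** Equality of the classes would give k in G with s^-1 k = k s, where s is
    [second_map]; on matrices this holds up to sign. *)
Lemma second_not_conj :
  conj_class G (second_map r1 r2 r3) <> conj_class G (second_inv r1 r2 r3).
Proof.
move=> E; have : conj_class G (second_inv r1 r2 r3) (second_inv r1 r2 r3).
  by exists id; [exact: id_in|].
rewrite -E => -[k Gk ek].
have [a [b [c [d [N1 dK hK]]]]] :=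
  triangle_lattice m1 m2 m3 tr1 tr2 tr3 dr1 dr2 dr3 tr12 tr13 tr23 Gk.
set K := qelt _ _ _ _ _ _ _ in dK hK.
have hS := second_mapP m1 m2 m3 dr1 dr2 dr3.
have hT := second_invP m1 m2 m3 dr1 dr2 dr3.
have [d1 h1] := homography_comp hT (conj dK hK).
have [d2 h2] := homography_comp (conj dK hK) hS.
rewrite ek in h1.
have tau2 : 2 < tau by move: lam1 lam_lt; rewrite /tau; lra.
have [] := @inverting_traceless _ (second_elt R1 R2 R3) (second_inv_elt R1 R2 R3) K.
- by case: hS.
- exact: second_eltK.
- by rewrite -normr_eq0 second_tr gt_eqF //; lra.
- by rewrite -real_normK ?num_real // second_tr gt_eqF //; nra.
- exact: homography_uniq d2 d1 h2 h1.
rewrite /K (trace_qelt tr12 tr13 tr23) -ev_qtrace.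
rewrite (trace_second_qelt sq1 sq2 sq3 tr1 tr2 tr3 tr12 tr13 tr23) -ev_qtrace2.
exact: no_inverting.
Qed.

Lemma spectrum_G : let L := 2 * arcosh (tau / 2) in
  second_least (length_spectrum G) L /\ `I_2 #<= classes_of_length G L.
Proof.
move=> L; have G1 := first_map_in m1 m2 m3 dr1 dr2 dr3.
have G2 := second_map_in m1 m2 m3 dr1 dr2 dr3.
have G3 := second_inv_in m1 m2 m3 dr1 dr2 dr3.
have [y1 l1] := first_len; have [y2 l2] := second_len.
have [y3 l3] := second_inv_len.
have lt12 : 2 * arcosh ((lam + 1) / 2) < L.
  by rewrite ltr_pM2l // arcosh_lt //; move: lam1 lam_lt; rewrite /tau; lra.
split; last first.
  apply: (two_card_le _ _ second_not_conj).
    by exists (second_map r1 r2 r3).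
  by exists (second_inv r1 r2 r3).
exists (2 * arcosh ((lam + 1) / 2)); split.
- by exists (first_map r1 r2 r3).
- move=> _ [f [Gf hf] <-]; have [t [t2 ht ->]] := len_in_group Gf hf.
  rewrite ler_pM2l // arcosh_le //; first by move: lam1; lra.
  by case: ht => [->//|]; move: lam1 lam_lt; rewrite /tau; lra.
- split; first by exists (second_map r1 r2 r3).
  by move=> /= h; move: lt12; rewrite h ltxx.
- move=> _ [[f [Gf hf] <-] ne]; have [t [t2 ht lf]] := len_in_group Gf hf.
  rewrite lf ler_pM2l // arcosh_le //; first by move: lam1 lam_lt; rewrite /tau; lra.
  case: ht => [tl|]; last by lra.
  by case: ne; rewrite lf tl.
Qed.

End Spectrum.

Theorem mainTheorem3 (R : realType) (q : nat) (hq : q = 5%N \/ q = 6%N)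
    (A B C : hplane R)
    (hT : triangle_with_angles A B C (pi / 3) (pi / 3) (pi / q%:R)) :
  let G := triangle_group A B C in
  let L := 2 * arcosh (2 * cos (pi / q%:R) ^+ 2 + cos (pi / q%:R) - 2^-1) in
  second_least (length_spectrum G) L /\ `I_2 #<= classes_of_length G L.
Proof.
move: hT => [[AB BC CA] [hA hB hC]] G.
set lam : R := 2 * cos (pi / q%:R).
have CB : C <> B by move=> h; exact: BC.
have BA : B <> A by move=> h; exact: AB.
have AC : A <> C by move=> h; exact: CA.
have trA : \tr (refl_mx A B * refl_mx C A) = -1.
  have := cos_angle AB AC; rewrite hA cos_pi3 [refl_mx A C]refl_mxC mulrN raddfN /=.
  lra.
have trB : \tr (refl_mx A B * refl_mx B C) = -1.
  have := cos_angle BC BA; rewrite hB cos_pi3 [refl_mx B A]refl_mxC mulrN raddfN /=.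
  rewrite -mulmxE mxtrace_mulC; lra.
have trC : \tr (refl_mx B C * refl_mx C A) = - lam.
  have := cos_angle CA CB; rewrite hC [refl_mx C B]refl_mxC mulrN raddfN /=.
  rewrite -mulmxE mxtrace_mulC /lam; lra.
have E : 2 * cos (pi / q%:R) ^+ 2 + cos (pi / q%:R) - 2^-1
    = (lam ^+ 2 + lam - 1) / 2 by rewrite /lam; field.
rewrite E.
have S := @spectrum_G R lam _ _ _ _ _ _ _ (moves_refl AB) (moves_refl BC)
  (moves_refl CA) (refl_mx_tr _ _) (refl_mx_tr _ _) (refl_mx_tr _ _)
  (refl_mx_det AB) (refl_mx_det BC) (refl_mx_det CA) trB trA trC.
case: hq => q_eq; subst q.
- have [l0 l2] := two_cos_pi5 R; rewrite -/lam in l0 l2.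
  have l1 : 1 < lam by nra.
  apply: (S (1 - lam)) => //.
  + by rewrite l2; lra.
  + by apply/andP; split; nra.
  + by move=> P; apply: trace_gap5.
  + by move=> a b c d; apply: no_inverting_element5.
- have [l0 l2] := two_cos_pi6 R; rewrite -/lam in l0 l2.
  have l1 : 1 < lam by nra.
  apply: (S (- lam)) => //.
  + by rewrite l2; lra.
  + by apply/andP; split; nra.
  + by move=> P; apply: trace_gap6.
  + by move=> a b c d; apply: no_inverting_element6.
Qed.
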